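(* Let $p$ be a pattern on the variables $x$ and $y$, and let $P=\{xxyyx, xyxyx, xxxyxy, xxxyyx, xxxyyy, xxyxxy, xxyxyy, xxyyyx, xyxxxy, xyxxyx, xyxyyx\}$. (a) If $p$ is equivalent to a factor of $xyx$, then $\lambda_\simeq(p)=\infty$. (b) If $p$ has a factor equivalent to $xxxx$ or to some pattern in $P$, then $\lambda_\simeq(p)=2$. (c) Otherwise, $\lambda_\simeq(p)=3$.
   Context: Patterns are words over variables. Two patterns $p,q$ on $\{x,y\}$ are equivalent if $q\in\{p,\overline{p},p^R,\overline{p}^R\}$, where $\overline{p}$ is the image of $p$ under the morphism $x\mapsto y$, $y\mapsto x$, and $p^R$ is the reversal of $p$. For words, $u\simeq u'$ iff $u'\in\{u,u^R\}$. A word $w$ encounters a pattern $p=p_1\cdots p_n$ up to $\simeq$ if it has a factor $X_1\cdots X_n$ with all $X_i$ nonempty and $X_i\simeq X_j$ whenever $p_i=p_j$; otherwise it avoids $p$ up to $\simeq$. The undirected avoidability index $\lambda_\simeq(p)$ is the least positive integer $k$ such that some infinite word over a $k$-letter alphabet avoids $p$ up to $\simeq$, or $\infty$ if none exists. *)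

(* Defs.v *)
From mathcomp Require Import all_boot boolp.

Set Implicit Arguments.
Unset Strict Implicit.
Unset Printing Implicit Defensive.

(* Patterns on the two variables x, y, encoded as x := false, y := true. *)
Definition pattern := seq bool.

Definition swap (p : pattern) : pattern := map negb p.

Definition equivalent (p q : pattern) : bool :=
  q \in [:: p; swap p; rev p; rev (swap p)].

(* u ~= u' : equality of words up to reversal. *)
Definition undirected_eq (A : eqType) (u u' : seq A) : bool :=
  u' \in [:: u; rev u].

Definition factor_of (A : Type) (w : nat -> A) (u : seq A) : Prop :=
  exists i, u = mkseq (fun j => w (i + j)) (size u).

(* X lists the blocks X_1, ..., X_n matched with the letters p_1 ... p_n. *)
Definition encounters (V : Type) (A : eqType) (w : nat -> A) (p : seq V) : Prop :=
  exists X : seq (seq A),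
    [/\ size X = size p,
        [::] \notin X,
        forall i j, i < size p -> j < size p -> onth p i = onth p j ->
          undirected_eq (nth [::] X i) (nth [::] X j)
      & factor_of w (flatten X)].

Definition avoidable_on (V : Type) (p : seq V) (k : nat) : Prop :=
  0 < k /\ exists w : nat -> 'I_k, ~ encounters w p.

(* The undirected avoidability index, with values in the positive integers
   extended by None, which stands for infinity. *)
Definition lambda (V : Type) (p : seq V) : option nat :=
  match pselect (exists k, `[< avoidable_on p k >]) with
  | left avoidable => Some (ex_minn avoidable)
  | right _ => None
  end.

Local Notation x := false.
Local Notation y := true.

Definition xyx : pattern := [:: x; y; x].

Definition xxxx : pattern := [:: x; x; x; x].

Definition P : seq pattern :=
  [:: [:: x; x; y; y; x];
      [:: x; y; x; y; x];
      [:: x; x; x; y; x; y];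
      [:: x; x; x; y; y; x];
      [:: x; x; x; y; y; y];
      [:: x; x; y; x; x; y];
      [:: x; x; y; x; y; y];
      [:: x; x; y; y; y; x];
      [:: x; y; x; x; x; y];
      [:: x; y; x; x; y; x];
      [:: x; y; x; y; y; x]].

Definition equivalent_to_factor_of_xyx (p : pattern) : Prop :=
  exists2 f, infix f xyx & equivalent p f.

Definition has_factor_equivalent_to_xxxx_or_P (p : pattern) : Prop :=
  exists2 f, infix f p & equivalent f xxxx \/ exists2 q, q \in P & equivalent f q.

(* Main.v *)
(* Unavoidability over two letters is shown by backtracking, except for xxxyxxx,
   which reduces to xxx: by compactness, an unavoidable pattern q occurs in some word
   that reappears later with a gap, so q y q is unavoidable as well (this also gives
   xyx from x). A word avoiding one of xx, xyxy (three letters) or of the minimal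
   patterns of P and xxxx (two letters) is a uniform image w of one fixed morphic word
   on four letters that has no factor zaz with a short and z long. The morphisms are
   chosen such that w has no long factor whose reversal is also a factor, and a factor
   zaz of w with long z comes from one of the source word. Hence long blocks of an
   occurrence that are equal up to reversal are equal, long blocks cannot be close to
   each other, all blocks of an occurrence are short, and a finite check remains. *)

Require Import Defs.
From mathcomp Require Import all_boot.
From mathcomp Require Import boolp zify.

Set Implicit Arguments.
Unset Strict Implicit.
Unset Printing Implicit Defensive.

(** * Equality up to reversal, and windows of infinite words *)

Section UndirectedEq.
Variable A : eqType.
Implicit Types u v t : seq A.

Lemma undirected_refl u : undirected_eq u u.
Proof. by rewrite /undirected_eq mem_head. Qed.

Lemma undirected_sym u v : undirected_eq u v = undirected_eq v u.
Proof.
by apply/idP/idP; rewrite /undirected_eq !inE => /orP[] /eqP->;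
  rewrite ?revK eqxx ?orbT.
Qed.

Lemma undirected_trans u v t :
  undirected_eq u v -> undirected_eq v t -> undirected_eq u t.
Proof.
rewrite /undirected_eq !inE => /orP[] /eqP-> /orP[] /eqP->;
  by rewrite ?revK eqxx ?orbT.
Qed.

Lemma undirected_rev u : undirected_eq u (rev u).
Proof. by rewrite /undirected_eq !inE eqxx orbT. Qed.

Lemma size_undirected u v : undirected_eq u v -> size v = size u.
Proof. by rewrite /undirected_eq !inE => /orP[] /eqP->; rewrite ?size_rev. Qed.

End UndirectedEq.

Lemma map_undirected (A B : eqType) (f : A -> B) (u v : seq A) :
  undirected_eq u v -> undirected_eq (map f u) (map f v).
Proof.
rewrite /undirected_eq !inE => /orP[] /eqP->; rewrite ?map_rev eqxx ?orbT //.
Qed.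

Definition window (A : Type) (w : nat -> A) i n := mkseq (fun j => w (i + j)) n.

Section Window.
Variables (A : Type) (w : nat -> A).

Lemma size_window i n : size (window w i n) = n.
Proof. exact: size_mkseq. Qed.

Lemma nth_window a i n j : j < n -> nth a (window w i n) j = w (i + j).
Proof. exact: nth_mkseq. Qed.

Lemma window_add i m n : window w i (m + n) = window w i m ++ window w (i + m) n.
Proof.
rewrite /window /mkseq iotaD map_cat add0n -[X in iota X n]addn0 iotaDl -map_comp.
by congr (_ ++ _); apply: eq_map => j /=; rewrite addnA.
Qed.

Lemma windowS i n : window w i n.+1 = w i :: window w i.+1 n.
Proof. by rewrite -add1n window_add addn1 /window /mkseq /= addn0. Qed.

Lemma window_rcons i n : window w i n.+1 = rcons (window w i n) (w (i + n)).
Proof. by rewrite -addn1 window_add cats1 /window /mkseq /= addn0. Qed.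

Lemma take_drop_window i n j m :
  j + m <= n -> take m (drop j (window w i n)) = window w (i + j) m.
Proof.
move=> le_n; rewrite -(subnKC le_n) -addnA !window_add drop_size_cat ?size_window //.
by rewrite take_size_cat ?size_window.
Qed.

Lemma cat_window u v i :
  u ++ v = window w i (size (u ++ v)) ->
  u = window w i (size u) /\ v = window w (i + size u) (size v).
Proof.
rewrite size_cat window_add => eq_uv; split.
  move/(congr1 (take (size u))): eq_uv.
  by rewrite !take_size_cat ?size_window.
move/(congr1 (drop (size u))): eq_uv.
by rewrite !drop_size_cat ?size_window.
Qed.

End Window.

Lemma map_window (A B : Type) (f : A -> B) (w : nat -> A) i n :
  map f (window w i n) = window (f \o w) i n.
Proof. by rewrite /window /mkseq -map_comp. Qed.

(** * Occurrences of patterns in finite and infinite words *)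

Section Occurrences.
Variable A : eqType.
Implicit Types (w : nat -> A) (sigma : bool -> seq A) (p : pattern).
Implicit Types (X : seq (seq A)).

(** One representative [sigma c] per variable replaces the pairwise condition of [encounters];
    transitivity of [undirected_eq] makes the two agree. *)
Definition realizes sigma p X := all2 (fun c u => undirected_eq (sigma c) u) p X.

Definition occurs_via (w : nat -> A) sigma p :=
  exists X i, realizes sigma p X /\ flatten X = window w i (size (flatten X)).

Definition occurs_in (u : seq A) p :=
  exists sigma X, [/\ forall c, sigma c != [::], realizes sigma p X
                    & infix (flatten X) u].

Lemma realizesP sigma p X :
  reflect (size X = size p /\
           forall j, j < size p ->
             undirected_eq (sigma (nth false p j)) (nth [::] X j))
          (realizes sigma p X).
Proof.
rewrite /realizes; elim: p X => [|c p IH] [|u X] /=.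
- by constructor.
- by constructor => -[].
- by constructor => -[].
apply: (iffP andP) => [[cu /IH[-> pX]]|[[eq_size] pX]].
  by split=> // -[|j] //; apply: pX.
by split; [exact: (pX 0) | apply/IH; split=> // j /(pX j.+1)].
Qed.

Lemma realizes_cat sigma p1 p2 X :
  realizes sigma (p1 ++ p2) X ->
  exists X1 X2, [/\ X = X1 ++ X2, realizes sigma p1 X1 & realizes sigma p2 X2].
Proof.
rewrite /realizes; elim: p1 X => [|c p1 IH] X /=; first by exists [::], X.
case: X => // u X /andP[cu] /IH[X1 [X2 [-> p1X1 p2X2]]].
by exists (u :: X1), X2; split; rewrite //= cu.
Qed.

Lemma cat_realizes sigma p1 p2 X1 X2 :
  realizes sigma p1 X1 -> realizes sigma p2 X2 ->
  realizes sigma (p1 ++ p2) (X1 ++ X2).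
Proof.
rewrite /realizes; elim: p1 X1 => [|c p1 IH] [|u X1] //= /andP[-> /IH]; exact.
Qed.

Lemma realizes_nil sigma X : realizes sigma [::] X -> X = [::].
Proof. by case: X. Qed.

Lemma realizes_cons sigma c p X : realizes sigma (c :: p) X ->
  exists u X', [/\ X = u :: X', undirected_eq (sigma c) u & realizes sigma p X'].
Proof. by case: X => // u X /andP[cu pX]; exists u, X. Qed.

Lemma realizes_rev sigma p X :
  realizes sigma p X -> realizes sigma (rev p) (rev (map rev X)).
Proof.
rewrite /realizes; elim: p X => [|c p IH] [|u X] //= /andP[cu /IH pX].
rewrite !rev_cons -!cats1; apply: cat_realizes => //=.
by rewrite /realizes /= (undirected_trans cu (undirected_rev u)).
Qed.

Lemma realizes_swap sigma p X :
  realizes sigma p X -> realizes (sigma \o negb) (swap p) X.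
Proof.
by rewrite /realizes; elim: p X => [|c p IH] [|u X] //= /andP[? /IH ->];
  rewrite negbK andbT.
Qed.

Lemma size_realizes sigma p X :
  realizes sigma p X -> size (flatten X) = \sum_(c <- p) size (sigma c).
Proof.
rewrite /realizes; elim: p X => [|c p IH] [|u X] //=; first by rewrite big_nil.
by case/andP=> /size_undirected cu /IH pX; rewrite size_cat cu pX big_cons.
Qed.

Lemma encountersP w p :
  encounters w p <->
  exists sigma, (forall c, sigma c != [::]) /\ occurs_via w sigma p.
Proof.
split=> [[X [eq_size X0 eqX [i fact]]]|[sigma [sigma0 [X [i [pX fact]]]]]].
  (* The block at the first position of [c] represents it; a variable absent from [p] gets an
     arbitrary letter, since [sigma] must be nonempty everywhere. *)
  pose sigma c := if c \in p then nth [::] X (index c p) else [:: w 0].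
  exists sigma; split=> [c|].
    rewrite /sigma; case: ifP => // cp; apply: contraNneq X0 => <-.
    by rewrite mem_nth // eq_size index_mem.
  exists X, i; split=> //; apply/realizesP; split=> // j jp.
  rewrite /sigma mem_nth //; apply: eqX; rewrite ?index_mem ?mem_nth //.
  by rewrite !onthE !(nth_map false) ?index_mem ?mem_nth // nth_index ?mem_nth.
have /realizesP[eq_size pX'] := pX.
exists X; split=> //; last by exists i.
  apply/negP => /(nthP [::])[j]; rewrite eq_size => /pX' /size_undirected + Xj.
  rewrite Xj => /esym/eqP; rewrite size_eq0; exact/negP.
move=> j1 j2 lt1 lt2; rewrite !onthE !(nth_map false) // => -[eq_p].
apply: undirected_trans (pX' _ lt2).
by rewrite undirected_sym -eq_p; apply: pX'.
Qed.

Lemma occurs_via_infix w sigma p f :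
  infix f p -> occurs_via w sigma p -> occurs_via w sigma f.
Proof.
move=> /infixP[p1 [p2 ->]] [X [i [/realizes_cat[X1 [X2 [-> _]]]]]].
move=> /realizes_cat[Xf [X3 [-> fXf _]]].
rewrite !flatten_cat => /cat_window[_ /cat_window[eqf _]].
by exists Xf, (i + size (flatten X1)).
Qed.

Lemma encounters_infix w p f : infix f p -> encounters w p -> encounters w f.
Proof.
move=> fp /encountersP[sigma [sigma0 occ]]; apply/encountersP.
by exists sigma; split=> //; apply: occurs_via_infix occ.
Qed.

Lemma window_split w i n (u1 u u2 : seq A) :
  window w i n = u1 ++ u ++ u2 -> u = window w (i + size u1) (size u).
Proof.
move=> eqw; have eq_n : n = size (u1 ++ u ++ u2) by rewrite -eqw size_window.
by move: eqw; rewrite eq_n => /esym/cat_window[_ /cat_window[]].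
Qed.

Lemma infix_window w i n (u : seq A) :
  infix u (window w i n) -> exists j, u = window w (i + j) (size u).
Proof.
by move=> /infixP[u1 [u2 /window_split ->]]; exists (size u1); rewrite size_window.
Qed.

Lemma occurs_in_encounters w i n p : occurs_in (window w i n) p -> encounters w p.
Proof.
move=> [sigma [X [sigma0 pX /infix_window[j eqX]]]]; apply/encountersP.
by exists sigma; split=> //; exists X, (i + j).
Qed.

Lemma encounters_occurs_in w p : encounters w p -> exists n, occurs_in (mkseq w n) p.
Proof.
move=> /encountersP[sigma [sigma0 [X [i [pX eqX]]]]].
exists (i + size (flatten X)), sigma, X; split=> //.
have -> n : mkseq w n = window w 0 n by [].
by rewrite window_add -eqX suffix_infix.
Qed.

Lemma occurs_in_rev u p : occurs_in u p -> occurs_in (rev u) (rev p).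
Proof.
move=> [sigma [X [sigma0 /realizes_rev pX Xu]]].
by exists sigma, (rev (map rev X)); rewrite -rev_flatten infix_rev.
Qed.

Lemma occurs_in_infix u v p : infix u v -> occurs_in u p -> occurs_in v p.
Proof.
move=> uv [sigma [X [? ? Xu]]].
by exists sigma, X; split=> //; apply: infix_trans uv.
Qed.

Lemma encounters_swap w p : encounters w p -> encounters w (swap p).
Proof.
move=> /encountersP[sigma [sigma0 [X [i [pX eqX]]]]]; apply/encountersP.
exists (sigma \o negb); split=> [c|]; first exact: sigma0.
by exists X, i; split=> //; apply: realizes_swap.
Qed.

End Occurrences.

Lemma encounters_map (A B : eqType) (f : A -> B) (w : nat -> A) (p : pattern) :
  encounters w p -> encounters (f \o w) p.
Proof.
move=> /encountersP[sigma [sigma0 [X [i [pX eqX]]]]]; apply/encountersP.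
exists (map f \o sigma); split=> [c|].
  by rewrite /= -size_eq0 size_map size_eq0.
exists (map (map f) X), i; split.
  rewrite /realizes; elim: p X pX {eqX} => [|c p IH] [|u X] //= /andP[cu /IH ->].
  by rewrite map_undirected.
by rewrite -map_flatten size_map -map_window -eqX.
Qed.

Lemma eq_encounters (A : eqType) (w w' : nat -> A) (p : pattern) :
  w =1 w' -> encounters w p -> encounters w' p.
Proof. by move=> /funext ->. Qed.

(** * Compactness *)

Section Koenig.
Variables (k : nat) (p : pattern).

Definition extendable (u : seq 'I_k) :=
  forall n, exists t, size t = n /\ ~ occurs_in (u ++ t) p.

(** If each letter [a] failed at some length [n a], an extension of [u] longer than all the [n a]
    could not avoid [p]: its prefix of [n a] letters after its first letter [a] already yields an
    occurrence. *)
Lemma extendable_rcons u : extendable u -> exists a, extendable (rcons u a).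
Proof.
move=> ext_u; apply: contrapT => no_ext.
have /choice[n nP] : forall a, exists n, forall t, size t = n ->
    occurs_in (rcons u a ++ t) p.
  move=> a; apply: contrapT => no_n; apply: no_ext; exists a => n.
  apply: contrapT => no_t; apply: no_n; exists n => t sz_t.
  by apply: contrapT => av; apply: no_t; exists t.
have [[|a t] [//= [sz_t] av]] := ext_u (\max_a n a).+1.
apply: av; apply: (@occurs_in_infix _ (rcons u a ++ take (n a) t)).
  by rewrite -[in X in infix _ X](cat_take_drop (n a) t) -cat_rcons catA prefix_infix.
by apply: nP; rewrite size_takel // sz_t leq_bigmax.
Qed.

(** Repeated one-letter extension gives an infinite branch. An occurrence in the branch would lie in
    a prefix, and every prefix is extendable, hence avoids [p]. *)
Lemma extendable_avoidable : 0 < k -> extendable [::] -> avoidable_on p k.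
Proof.
move=> k_gt0 ext0; split=> //.
pose a0 : 'I_k := Ordinal k_gt0.
have /choice[step stepP] : forall s : {u | extendable u},
    exists a, extendable (rcons (sval s) a).
  by case=> u ext_u; apply: extendable_rcons.
pose chain := fix chain n := if n is m.+1
  then exist extendable _ (stepP (chain m)) else exist extendable _ ext0.
pose w n := step (chain n).
have chainE n : sval (chain n) = mkseq w n.
  elim: n => //= n ->.
  by rewrite -[mkseq w n.+1]/(window w 0 n.+1) window_rcons.
exists w => /encounters_occurs_in[n].
rewrite -chainE; case: (chain n) => u ext_u /=.
by have [t [/size0nil-> ]] := ext_u 0; rewrite cats0.
Qed.

Lemma avoidable_extendable : avoidable_on p k -> extendable [::].
Proof.
move=> [_ [w av]] n; exists (mkseq w n); rewrite size_mkseq; split=> // occ.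
exact/av/(@occurs_in_encounters _ w 0 n).
Qed.

End Koenig.

(** * Equivalent patterns, factors, and the sandwich of an unavoidable pattern *)

Implicit Types p q : pattern.

(** An infinite word has no reversal, so its finite prefixes are reversed and compactness leads back
    to an infinite word. *)
Lemma avoidable_rev p k : avoidable_on p k -> avoidable_on (rev p) k.
Proof.
move=> av; have k_gt0 := av.1; apply: extendable_avoidable => // n.
have [t [sz_t no_t]] := avoidable_extendable av n.
exists (rev t); rewrite size_rev; split=> // /occurs_in_rev.
by rewrite !revK.
Qed.

Lemma swapK : involutive swap.
Proof. by move=> p; rewrite /swap mapK //; apply: negbK. Qed.

Lemma avoidable_swap p k : avoidable_on p k -> avoidable_on (swap p) k.
Proof.
move=> [k_gt0 [w av]]; split=> //; exists w => /encounters_swap.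
by rewrite swapK.
Qed.

Lemma equivalent_sym p q : equivalent p q -> equivalent q p.
Proof.
have swap_rev u : swap (rev u) = rev (swap u) by rewrite /swap map_rev.
rewrite /equivalent !inE => /or4P[] /eqP->;
  by rewrite ?swap_rev ?swapK ?revK eqxx ?orbT.
Qed.

Lemma avoidable_equivalent p q k :
  equivalent p q -> avoidable_on p k -> avoidable_on q k.
Proof.
rewrite /equivalent !inE => /or4P[] /eqP-> // av.
- exact: avoidable_swap.
- exact: avoidable_rev.
- exact/avoidable_rev/avoidable_swap.
Qed.

Lemma avoidable_infix (f p : pattern) k :
  infix f p -> avoidable_on f k -> avoidable_on p k.
Proof.
by move=> fp [k_gt0 [w av]]; split=> //; exists w => /(encounters_infix fp).
Qed.

(* By compactness, an unavoidable pattern occurs in every word of some length N,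
   so some word of length N occurs twice with a gap. *)
Lemma unavoidable_sandwich m k :
  ~ avoidable_on (nseq m false) k ->
  ~ avoidable_on (nseq m false ++ true :: nseq m false) k.
Proof.
set q := nseq m false => unav [k_gt0 [w av]].
have /existsNP[N allN] : ~ extendable q ([::] : seq 'I_k).
  by move=> /(extendable_avoidable k_gt0).
have {}allN (u : seq 'I_k) : size u = N -> occurs_in u q.
  by move=> sz_u; apply: contrapT => no_u; apply: allN; exists u.
(* The starting points are multiples of [N.+1], so distinct windows have at least one letter between
   them; there is one window more than there are words of length [N]. *)
pose g (i : 'I_(#|{: N.-tuple 'I_k}|.+1)) : N.-tuple 'I_k :=
  tcast (size_window w (i * N.+1) N) (in_tuple (window w (i * N.+1) N)).
have gE i : g i = window w (i * N.+1) N :> seq _ by rewrite val_tcast.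
have [i [j [lt_ij eq_g]]] : exists i j : 'I_(#|{: N.-tuple 'I_k}|.+1),
    i < j /\ g i = g j.
  have /injectivePn[i [j ij eq_g]] : ~~ injectiveb g.
    by apply/injectiveP => /leq_card; rewrite card_ord ltnn.
  case: (ltngtP i j) => [lt_ij|lt_ji|/val_inj eq_ij].
  - by exists i, j.
  - by exists j, i.
  - by rewrite eq_ij eqxx in ij.
have [sigma [X [sigma0 qX /infixP[u1 [u2 eqX]]]]] := allN (g i) (size_tuple _).
move/(congr1 val): (eq_g); rewrite /= !gE => eq_w.
pose a := i * N.+1 + size u1; pose n := size (flatten X).
have sz_g : N = size u1 + (n + size u2).
  by rewrite -!size_cat -eqX size_tuple.
have wi : flatten X = window w a n.
  by apply: (@window_split _ _ _ N _ _ u2); rewrite -gE.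
have wj : flatten X = window w (j * N.+1 + size u1) n.
  by apply: (@window_split _ _ _ N _ _ u2); rewrite -eq_w -gE.
pose Y := window w (a + n) (j * N.+1 + size u1 - (a + n)).
have le_aj : i * N.+1 + N < j * N.+1.
  have : i.+1 * N.+1 <= j * N.+1 by rewrite leq_mul2r lt_ij orbT.
  by rewrite mulSn; lia.
have lt_aj : a + n < j * N.+1 + size u1 by rewrite /a; lia.
apply: av; apply/encountersP.
exists (fun c => if c then Y else sigma c); split.
  case=> //; rewrite -size_eq0 size_window subn_eq0 -ltnNge //.
have qX' s : s false = sigma false -> realizes s q X.
  move=> eq_s; rewrite /q; move: qX; rewrite /q /realizes.
  by elim: (m) (X) => [|m' IH] [|u X'] //= /andP[]; rewrite eq_s => -> /IH.
exists (X ++ Y :: X), a; split.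
  apply: cat_realizes; rewrite ?qX' //=.
  by rewrite /realizes /= undirected_refl; apply: qX'.
rewrite flatten_cat /= !size_cat !window_add -/n -wi; congr (_ ++ _ ++ _).
  by rewrite {1}/Y size_window.
rewrite size_window wj; congr (window w _ n); lia.
Qed.

(** * Search for occurrences with bounded block lengths, and for repetitions *)

Fixpoint strip (u r : seq nat) : option (seq nat) :=
  match u, r with
  | [::], _ => Some r
  | a :: u', b :: r' => if eqn a b then strip u' r' else None
  | _, _ => None
  end.

(* Tries the block lengths from skip+1 to skip+len, passing the block reversed. *)
Fixpoint match_block (K : seq nat -> seq nat -> bool) (skip len : nat)
    (acc r : seq nat) {struct r} : bool :=
  if r is a :: r' then
    match skip, len with
    | s.+1, _ => match_block K s len (a :: acc) r'
    | 0, l.+1 => if K (a :: acc) r' then true else match_block K 0 l (a :: acc) r'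
    | 0, 0 => false
    end
  else false.

Definition upd (env : bool -> option (seq nat)) (c : bool) (u : seq nat) d :=
  if d (+) c then env d else Some u.

(* Conditionals rather than || keep the evaluation short-circuited under
   vm_compute, which is strict. *)
Fixpoint matches (lo len : bool -> nat) (p : pattern)
    (env : bool -> option (seq nat)) (r : seq nat) {struct p} : bool :=
  if p is c :: p' then
    match env c with
    | Some u =>
        if (if strip u r is Some r' then matches lo len p' env r' else false)
        then true
        else if strip (rev u) r is Some r' then matches lo len p' env r' else false
    | None =>
        match_block (fun u => matches lo len p' (upd env c u)) (lo c) (len c) [::] r
    end
  else true.

Definition no_env (c : bool) : option (seq nat) := None.

Lemma stripP u r r' : strip u r = Some r' <-> r = u ++ r'.
Proof.
elim: u r => [|a u IH] [|b r] /=.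
- by split=> [[->]|->].
- by split=> [[->]|->].
- by split.
case: (@eqnP a b) => [->|ab].
  by rewrite IH; split=> [->|[]].
by split=> // -[/esym].
Qed.

Lemma match_blockP K skip len acc r :
  match_block K skip len acc r <->
  exists u r', [/\ r = u ++ r', skip < size u <= skip + len & K (catrev u acc) r'].
Proof.
elim: r skip len acc => [|a r IH] [|s] len acc.
- by split=> // -[[|? ?] [? [] //]].
- by split=> // -[[|? ?] [? [] //]].
- case: len => [|l] /=.
    by split=> // -[[|? ?] [? []]].
  case: ifP => [Ka|nKa].
    by split=> // _; exists [:: a], r.
  rewrite IH; split=> [[u [r' [-> lu Ku]]]|[[|b u] [r' [// [<- eq_r] lu Ku]]]].
    by exists (a :: u), r'; split=> //=; lia.
  exists u, r'; split=> //; case: u eq_r lu Ku => [eq_r _|? ? _ /=]; last by lia.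
  by rewrite /= -[r']/([::] ++ r') -eq_r nKa.
- rewrite /= IH; split=> [[u [r' [-> lu Ku]]]|[[|b u] [r' [// [<- ->] lu Ku]]]].
    by exists (a :: u), r'; split=> //=; lia.
  by exists u, r'; split=> //; move: lu => /=; lia.
Qed.

(** Backtracking relies on this direction: a positive answer comes with an occurrence, whatever the
    length bounds are. *)
Lemma matches_sound lo len p env r :
  (forall c u, env c = Some u -> u != [::]) -> matches lo len p env r ->
  exists sigma X r', [/\ forall c, sigma c != [::],
    forall c u, env c = Some u -> sigma c = u, realizes sigma p X
    & r = flatten X ++ r'].
Proof.
elim: p env r => [|c p IH] env r env0 /=.
  (* Variables still unbound at the end of the pattern receive a one-letter default. *)
  exists (fun c => odflt [:: 0] (env c)), [::], r; split=> // [c|c u -> //].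
  by case eq_c: (env c) => [u|] //=; apply: env0 eq_c.
case eq_c: (env c) => [u|].
  have step u' : undirected_eq u u' ->
      (if strip u' r is Some r' then matches lo len p env r' else false) ->
      exists sigma X r', [/\ forall c, sigma c != [::],
        forall c u, env c = Some u -> sigma c = u, realizes sigma (c :: p) X
        & r = flatten X ++ r'].
    move=> uu'; case eq_r: (strip u' r) => [r'|] // /(IH _ _ env0).
    move=> [sigma [X [r'' [sigma0 sigmaE pX eq_r']]]].
    exists sigma, (u' :: X), r''; split=> //.
      by rewrite /realizes /= (sigmaE _ _ eq_c) uu'.
    by move/stripP: eq_r => ->; rewrite eq_r' /= catA.
  case: ifP => [+ _|_]; first exact/step/undirected_refl.
  exact/step/undirected_rev.
move=> /match_blockP[u [r' [-> /andP[lu _]]]].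
rewrite -/(rev u) => /IH[d u'|sigma [X [r'' [sigma0 sigmaE pX ->]]]].
  rewrite /upd; case: ifP => _; first exact: env0.
  by case=> <-; rewrite -size_eq0 size_rev -lt0n (leq_ltn_trans _ lu).
exists sigma, (u :: X), r''; split=> //; last by rewrite /= catA.
  move=> d u' eq_d; apply: sigmaE; rewrite /upd; case: ifP => // /negbT.
  by rewrite negb_add => /eqP eq_dc; rewrite eq_dc eq_c in eq_d.
apply/andP; split=> //; rewrite (sigmaE c (rev u)); last by rewrite /upd addbb.
by rewrite undirected_sym undirected_rev.
Qed.

(** Avoidance relies on this direction: a negative answer excludes every occurrence whose block
    lengths respect the bounds. *)
Lemma matches_complete lo len sigma p env X r :
  realizes sigma p X ->
  (forall c u, env c = Some u -> undirected_eq (sigma c) u) ->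
  (forall c, c \in p -> lo c < size (sigma c) <= lo c + len c) ->
  matches lo len p env (flatten X ++ r).
Proof.
elim: p env X => [|c p IH] env [|x X] //= /andP[cx pX] envE bnd.
have bnd' d : d \in p -> lo d < size (sigma d) <= lo d + len d.
  by move=> dp; apply: bnd; rewrite inE dp orbT.
rewrite -catA; case eq_c: (env c) => [u|].
  have := undirected_trans (etrans (undirected_sym _ _) (envE _ _ eq_c)) cx.
  rewrite /undirected_eq !inE => /orP[] /eqP ->.
    have /stripP -> : u ++ flatten X ++ r = u ++ (flatten X ++ r) by [].
    by rewrite IH.
  case: ifP => // _.
  have /stripP -> : rev u ++ flatten X ++ r = rev u ++ (flatten X ++ r) by [].
  by rewrite IH.
apply/match_blockP; exists x, (flatten X ++ r); split=> //.
  by rewrite (size_undirected cx) bnd ?mem_head.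
apply: IH => // d u; rewrite -/(rev x) /upd; case: ifP => [_|/negbT]; first exact: envE.
rewrite negb_add => /eqP -> [<-].
exact/(undirected_trans cx)/undirected_rev.
Qed.

(* A word that is exhausted counts as agreeing, so a negative answer is conclusive
   whatever the lengths are. *)
Fixpoint agree (n : nat) (r s : seq nat) : bool :=
  match n, r, s with
  | m.+1, a :: r', b :: s' => if eqn a b then agree m r' s' else false
  | _, _, _ => true
  end.

Lemma agreeP n r s :
  (forall t, t < n -> t < size r -> t < size s -> nth 0 r t = nth 0 s t) ->
  agree n r s.
Proof.
elim: n r s => [|n IH] [|a r] [|b s] //= eq_rs.
have /= -> := eq_rs 0 isT isT isT; rewrite eqnE eqxx.
by apply: IH => t tn tr ts; apply: (eq_rs t.+1).
Qed.

(* In a factor zaz, n = |z| and P = |za|. *)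
Definition repeats (w : nat -> nat) i P n :=
  forall j, j < n -> w (i + j) = w (i + P + j).

Lemma repeats_agree w i P n m N :
  m <= n -> repeats w i P n -> agree m (window w i N) (drop P (window w i N)).
Proof.
move=> mn rep; apply: agreeP => t tm; rewrite size_drop size_window => tN tNP.
rewrite nth_drop !nth_window; [|lia..].
by rewrite rep ?addnA //; lia.
Qed.

(** Entry [P] of [ns] is the length at which period [P.+1] is excluded at the start of [r]; [s] is
    the suffix of [r] reached so far. Running out of letters before [ns] ends counts as failure. *)
Fixpoint no_repeats (ns : seq nat) (r s : seq nat) : bool :=
  match ns, s with
  | n :: ns', _ :: s' => if agree n r s' then false else no_repeats ns' r s'
  | [::], _ => true
  | _, [::] => false
  end.

Lemma no_repeats_drop ns r d P : no_repeats ns r (drop d r) -> P < size ns ->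
  ~~ agree (nth 0 ns P) r (drop (d + P).+1 r).
Proof.
elim: ns P d => [|n ns IH] P d //=.
case eq_d: (drop d r) => [|a s] //.
have -> : s = drop d.+1 r by rewrite -add1n -drop_drop eq_d /= drop0.
case: ifP => // /negbT nag /IH {}IH.
case: P => [|P]; first by rewrite addn0.
by move=> /IH; rewrite addnS.
Qed.

Lemma no_repeatsP ns r P : no_repeats ns r r -> P < size ns ->
  ~~ agree (nth 0 ns P) r (drop P.+1 r).
Proof. by rewrite -{2}[r]drop0 => /no_repeats_drop; apply. Qed.

(** * Images of words under uniform morphisms *)

Section Image.
Variables (u : nat -> nat) (h : seq (seq nat)) (q : nat).

Definition image_word i := nth 0 (nth [::] h (u (i %/ q))) (i %% q).

Definition apply_morphism (a : seq nat) := flatten (map (nth [::] h) a).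

Definition image_windows (F : seq (seq nat)) n :=
  [seq take n (drop j b) | b <- map apply_morphism F, j <- iota 0 q].

(** Under this condition [n] consecutive letters of the image determine their position modulo [q],
    that is, where the block boundaries lie. *)
Definition synchronizing (F : seq (seq nat)) n :=
  let B := map apply_morphism F in
  pairwise (fun S T => all (fun s => all (fun t => ~~ agree n s t) T) S)
    [seq map (drop j) B | j <- iota 0 q].

Hypothesis q_gt0 : 0 < q.
Hypothesis size_h : all (fun s => size s == q) h.
Hypothesis u_lt : forall i, u i < size h.

Lemma size_nth_h i : size (nth [::] h (u i)) = q.
Proof. by apply/eqP/(all_nthP [::] size_h). Qed.

Lemma imageE m t : t < q -> image_word (q * m + t) = nth 0 (nth [::] h (u m)) t.
Proof.
move=> tq; rewrite /image_word mulnC divnMDl // divn_small // addn0.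
by rewrite modnMDl modn_small.
Qed.

Lemma apply_morphism_window i n :
  apply_morphism (window u i n) = window image_word (q * i) (q * n).
Proof.
elim: n i => [|n IH] i; first by rewrite muln0.
rewrite windowS /apply_morphism /= -/(apply_morphism _) IH.
rewrite [in RHS]mulnS window_add -mulnSr.
congr (_ ++ _); apply: (@eq_from_nth _ 0); rewrite ?size_window size_nth_h // => t tq.
by rewrite nth_window // imageE.
Qed.

(** The bound on [n] says that an offset of at most [q - 1] followed by [n] letters fits into [k]
    blocks. *)
Lemma window_image F k n i : (forall i', window u i' k \in F) -> n + q <= (q * k).+1 ->
  exists2 b, b \in map apply_morphism F &
    window image_word i n = take n (drop (i %% q) b).
Proof.
move=> Fk le_n; exists (apply_morphism (window u (i %/ q) k)); first exact: map_f.
rewrite apply_morphism_window take_drop_window; last by have := ltn_pmod i q_gt0; lia.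
by rewrite mulnC -divn_eq.
Qed.

Lemma mem_image_windows F k n i :
  (forall i', window u i' k \in F) -> n + q <= (q * k).+1 ->
  window image_word i n \in image_windows F n.
Proof.
move=> Fk /(window_image i Fk)[b bF ->].
by apply: (allpairs_f (fun b j => take n (drop j b))); rewrite ?mem_iota ?ltn_pmod.
Qed.

Lemma synchronizingP F k n i i' :
  (forall i', window u i' k \in F) -> n + q <= (q * k).+1 -> synchronizing F n ->
  (forall t, t < n -> image_word (i + t) = image_word (i' + t)) -> i = i' %[mod q].
Proof.
move=> Fk le_n sync; wlog lt_ii' : i i' / i %% q < i' %% q => [hwlog|] eq_im.
  case: (ltngtP (i %% q) (i' %% q)) => // lt_i; first exact: hwlog lt_i eq_im.
  by apply/esym/(hwlog _ _ lt_i) => t /eq_im.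
have [b bF eq_b] := window_image i Fk le_n.
have [b' b'F eq_b'] := window_image i' Fk le_n.
have /= := pairwiseP [::] sync (i %% q) (i' %% q).
rewrite !inE !size_map size_iota !ltn_pmod // => /(_ isT isT lt_ii').
rewrite !(nth_map 0) ?size_iota ?ltn_pmod // !nth_iota ?ltn_pmod // !add0n.
move=> /allP/(_ (drop (i %% q) b) (map_f _ bF)).
move=> /allP/(_ (drop (i' %% q) b') (map_f _ b'F)) /negP[].
apply: agreeP => t tn _ _; rewrite -(nth_take 0 tn) -[RHS](nth_take 0 tn).
by rewrite -eq_b -eq_b' !nth_window // eq_im.
Qed.

(** Synchronization forces [q] to divide [P]. The complete blocks inside the repeated word then
    match, and distinctness of the blocks of [h] turns this into equal source letters; at most
    [q - 1] letters are lost at each end. *)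
Lemma repeats_image i P n l :
  (forall a b, (forall t, t < l -> image_word (a + t) = image_word (b + t)) ->
     a = b %[mod q]) ->
  uniq h -> l <= n -> repeats image_word i P n ->
  exists i' P' n', [/\ P = q * P', n + 2 <= q * n' + 2 * q, q * n' <= n
    & repeats u i' P' n'].
Proof.
move=> sync uniq_h ln rep.
have dvdP : q %| P.
  have /eqP : i = i + P %[mod q] by apply: sync => t tl; apply: rep; lia.
  by rewrite -[X in X == _ %[mod _]]addn0 eqn_modDl mod0n eq_sym.
have eq_P : P = q * (P %/ q) by rewrite mulnC divnK.
(* The first block boundary at or after [i], and the last one at or before [i + n]. *)
pose i' := (i + q.-1) %/ q; pose e := (i + n) %/ q.
have le_e : q * e <= i + n by rewrite mulnC leq_trunc_div.
have gt_e : i + n < q * e.+1 by rewrite mulnC ltn_ceil.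
have ge_i : i <= q * i'.
  by have := ltn_ceil (i + q.-1) q_gt0; rewrite -/i' mulnC mulnS; lia.
have le_i : q * i' <= i + q.-1 by rewrite mulnC leq_trunc_div.
exists i', (P %/ q), (e - i'); split=> // [||j jn].
- by rewrite mulnBr; move: gt_e; rewrite mulnS; lia.
- by rewrite mulnBr; lia.
have le_j : q * (i' + j).+1 <= q * e by rewrite leq_mul2l; apply/orP; right; lia.
apply/eqP; rewrite -(nth_uniq [::] _ _ uniq_h) //; apply/eqP.
apply: (@eq_from_nth _ 0); rewrite !size_nth_h // => t tq.
rewrite -!imageE //.
have -> : q * (i' + j) + t = i + (q * (i' + j) + t - i).
  by rewrite subnKC // mulnDr; lia.
rewrite rep; last by move: le_j; rewrite mulnS mulnDr; lia.
by congr image_word; rewrite {1}eq_P !mulnDr; lia.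
Qed.

End Image.

(** * The source word on four letters and its repetitions *)

Definition g : seq (seq nat) :=
  [:: [:: 0; 1; 2]; [:: 1; 0; 3]; [:: 1; 2; 3]; [:: 0; 3; 2]].

Fixpoint source_rec d i :=
  if d is d'.+1 then nth 0 (nth [::] g (source_rec d' (i %/ 3))) (i %% 3) else 0.

(* The fixed point of g beginning with 0; any d >= i gives the same letter. *)
Definition source i := source_rec i i.

Lemma sourceE i : source i = image_word source g 3 i.
Proof.
have rec_eq d e j : j <= d -> j <= e -> source_rec d j = source_rec e j.
  elim: d e j => [|d IH] [|e] j //=.
  - by rewrite leqn0 => /eqP-> _; elim: e => //= e <-.
  - by move=> _; rewrite leqn0 => /eqP->; elim: d {IH} => //= d ->.
  case: j => [|j] jd je; first by rewrite div0n (IH e).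
  have lt_j : j.+1 %/ 3 <= j by rewrite -ltnS ltn_Pdiv.
  by rewrite (IH e) // (leq_trans lt_j).
case: i => [|i] //; rewrite /image_word /source [LHS]/=.
by congr (nth 0 (nth [::] g _) _); apply: rec_eq => //; rewrite -ltnS ltn_Pdiv.
Qed.

Lemma letters_bounded k h :
  all (all (fun a => a < k)) h -> 0 < k -> forall c t, nth 0 (nth [::] h c) t < k.
Proof.
move=> hk k_gt0 c t; have [ch|hc] := ltnP c (size h); last first.
  by rewrite (nth_default [::] hc) nth_nil.
have /(all_nthP 0) hck := all_nthP [::] hk c ch.
have [tc|ct] := ltnP t (size (nth [::] h c)); first exact: hck.
by rewrite nth_default.
Qed.

Lemma source_lt i : source i < size g.
Proof. by rewrite sourceE; apply: letters_bounded. Qed.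

Definition source_pairs : seq (seq nat) :=
  [:: [:: 0; 1]; [:: 1; 2]; [:: 2; 1]; [:: 1; 0]; [:: 0; 3]; [:: 3; 1]; [:: 2; 3];
      [:: 3; 2]; [:: 2; 0]; [:: 3; 0]].

(** The list contains the first pair and is closed under taking pairs from images of its members;
    the pair at [i.+1] lies in the image of the pair at the smaller position [i.+1 %/ 3]. *)
Lemma source_pairsP i : window source i 2 \in source_pairs.
Proof.
have closed :
    all (fun b => all (fun j => take 2 (drop j b) \in source_pairs) (iota 0 3))
      (map (apply_morphism g) source_pairs) by vm_compute.
have /funext sE : source =1 image_word source g 3 := sourceE.
elim/ltn_ind: i => -[|i] IH //.
have lt_i : i.+1 %/ 3 < i.+1 by rewrite ltn_Pdiv.
have lt_m := ltn_pmod i.+1 (isT : 0 < 3).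
have -> : window source i.+1 2 =
    take 2 (drop (i.+1 %% 3) (apply_morphism g (window source (i.+1 %/ 3) 2))).
  rewrite (@apply_morphism_window source g 3) -?sE //; last exact: source_lt.
  rewrite take_drop_window; last by lia.
  by rewrite mulnC -divn_eq.
have /allP/(_ _ (map_f _ (IH _ lt_i)))/allP := closed.
by apply; rewrite mem_iota.
Qed.

Fixpoint same_word (r s : seq nat) : bool :=
  match r, s with
  | [::], [::] => true
  | a :: r', b :: s' => if eqn a b then same_word r' s' else false
  | _, _ => false
  end.

Definition dedup (F : seq (seq nat)) :=
  foldr (fun r D => if has (same_word r) D then D else r :: D) [::] F.

Lemma mem_dedup F r : r \in F -> r \in dedup F.
Proof.
have same r' s : same_word r' s -> r' = s.
  elim: r' s => [|a r' IH] [|b s] //=; rewrite eqnE.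
  by case: eqP => // -> /IH ->.
elim: F => //= s F IH; rewrite inE => /orP[/eqP-> | /IH rF].
  case: ifP => [/hasP[t tF /same ->] //|_]; exact: mem_head.
by case: ifP => // _; rewrite inE rF orbT.
Qed.

(** A window of length [n] lies in the image of [(n + 4) %/ 3] letters, the least [k] with
    [n + 2 <= 3 * k]; [d] is fuel. *)
Fixpoint source_windows_rec d n :=
  if n <= 2 then map (take n) source_pairs
  else if d is d'.+1
    then dedup (image_windows g 3 (source_windows_rec d' ((n + 4) %/ 3)) n)
    else [::].

Definition source_windows n := source_windows_rec n n.

Lemma source_windowsP n i : window source i n \in source_windows n.
Proof.
have recE d m : source_windows_rec d m =
    if m <= 2 then map (take m) source_pairs
    else if d is d'.+1
      then dedup (image_windows g 3 (source_windows_rec d' ((m + 4) %/ 3)) m)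
      else [::] by case: d.
suff windows d m j : m <= d.+2 -> window source j m \in source_windows_rec d m.
  by apply: windows; lia.
elim/ltn_ind: d m j {n i} => d IH n i le_n; rewrite recE.
case: ifP => [le_n2|/negbT gt_n].
  apply/mapP; exists (window source i 2); first exact: source_pairsP.
  by rewrite -[X in take n X]drop0 take_drop_window // addn0.
case: d IH le_n => [|d] IH le_n; first by rewrite le_n in gt_n.
have /funext sE : source =1 image_word source g 3 := sourceE.
apply: mem_dedup; rewrite {1}sE.
apply: (@mem_image_windows source g 3 isT isT source_lt _ ((n + 4) %/ 3)).
- by move=> i'; apply: IH => //; lia.
- lia.
Qed.

Lemma source_sync a b :
  (forall t, t < 3 -> source (a + t) = source (b + t)) -> a = b %[mod 3].
Proof.
have /funext sE : source =1 image_word source g 3 := sourceE.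
rewrite sE => eq_ab.
apply: (@synchronizingP source g 3 isT isT source_lt (source_windows 2) 2 3) eq_ab
  => // i.
exact: source_windowsP.
Qed.

(** The entry for [P] is the least [n] with [2 * P < 3 * n]. Periods up to 36 are enough for
    [n <= 28] and [P <= n + 8]. *)
Definition source_thresholds := [seq (2 * P) %/ 3 + 1 | P <- iota 1 36].

(** The length 61 is the largest period 36 plus its threshold 25, so no comparison runs out of
    letters. *)
Lemma source_no_repeats :
  all (fun r => no_repeats source_thresholds r r) (source_windows 61).
Proof. by vm_cast_no_check (erefl true). Qed.

(* An occurrence of zaz with |z| >= 29 comes from a shorter one, with |a| <= 4. *)
Lemma source_repeats i P n :
  0 < P -> P <= n + 8 -> 2 * P < 3 * n -> ~ repeats source i P n.
Proof.
have /funext sE : source =1 image_word source g 3 := sourceE.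
elim/ltn_ind: n i P => n IH i P P_gt0 P_le lt_Pn rep.
have [n_lt|n_ge] := ltnP n 29.
  have P_lt : P.-1 < size source_thresholds by rewrite size_map size_iota; lia.
  have := no_repeatsP (allP source_no_repeats _ (source_windowsP 61 i)) P_lt.
  rewrite prednK // => /negP[].
  rewrite (nth_map 0) ?size_iota ?nth_iota; [|lia..].
  by apply: repeats_agree rep; lia.
have sync a b : (forall t, t < 3 -> image_word source g 3 (a + t) =
    image_word source g 3 (b + t)) -> a = b %[mod 3].
  by rewrite -sE; apply: source_sync.
have n_ge3 : 3 <= n by lia.
move: (rep); rewrite {1}sE.
move=> /(@repeats_image source g 3 isT isT source_lt _ _ _ _ sync isT n_ge3).
move=> [i' [P' [n' [eq_P le_n ge_n rep']]]].
(* From [3 * P' <= n + 8] and [n <= 3 * n' + 4] follows [P' <= n' + 4]; [29 <= n] gives [9 <= n'],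
   whence [2 * P' < 3 * n']. *)
have [n'_lt P'_gt0 P'_le lt_Pn'] : [/\ n' < n, 0 < P', P' <= n' + 8 & 2 * P' < 3 * n'].
  by split; lia.
exact: IH n'_lt i' P' P'_gt0 P'_le lt_Pn' rep'.
Qed.

(** * Bounds on the lengths of blocks *)

(** The excluded factors have length [L.+1]; the case [a = b] excludes palindromes. *)
Definition reverse_free (w : nat -> nat) L :=
  forall a b, ~ (forall t, t <= L -> w (a + t) = w (b + (L - t))).

(** For [P < n] the two copies of the repeated word overlap; this case is excluded too. *)
Definition gap_free (w : nat -> nat) G M :=
  forall i P n, 0 < P -> P <= n + G -> M <= n -> ~ repeats w i P n.

Section LongBlocks.
Variables (w : nat -> nat) (L G M : nat) (sigma : bool -> seq nat).
Hypotheses (w_rev : reverse_free w L) (w_gap : gap_free w G M) (lt_LM : L < M).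

(** Were the blocks reversals of each other, the first [L.+1] letters of one would be the reversed
    last [L.+1] letters of the other, against [w_rev]. *)
Lemma long_blocks_eq n a b :
  L < n -> undirected_eq (window w a n) (window w b n) ->
  forall t, t < n -> w (a + t) = w (b + t).
Proof.
move=> Ln; rewrite /undirected_eq !inE => /orP[] /eqP eq_ab t tn.
  by rewrite -!(@nth_window _ _ 0 _ n) // eq_ab.
case: (@w_rev a (b + (n - L.+1))) => s sL.
rewrite -addnA -!(@nth_window _ w 0 _ n); [|lia..].
by rewrite eq_ab nth_rev size_window; [congr nth|]; lia.
Qed.

(** Blocks of length at least [M] exceed [L], so the two outer blocks are equal; with at most [G]
    letters between them they form a factor zaz that [w_gap] excludes. *)
Lemma gap_block c m :
  occurs_via w sigma (c :: rcons m c) -> \sum_(d <- m) size (sigma d) <= G ->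
  size (sigma c) < M.
Proof.
move=> [X [i [/realizes_cons[u [X' [-> cu]]]]]].
rewrite -cats1 => /realizes_cat[Xm [X'' [-> mXm]]].
move=> /realizes_cons[v [? [-> cv /realizes_nil ->]]].
rewrite /= flatten_cat /= cats0 => /cat_window[eq_u /cat_window[_ eq_v]] le_G.
rewrite ltnNge; apply/negP => le_M; set n := size (sigma c) in le_M *.
have sz_u : size u = n := size_undirected cu.
have sz_v : size v = n := size_undirected cv.
rewrite -(size_realizes mXm) in le_G.
apply: (@w_gap i (n + size (flatten Xm)) n); [lia..|].
move=> t tn; rewrite addnA; apply: long_blocks_eq tn; first by lia.
rewrite sz_u in eq_u eq_v; rewrite sz_v in eq_v; rewrite -eq_u -eq_v.
by apply: undirected_trans cv; rewrite undirected_sym.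
Qed.

(** If the blocks of one variable have length at most [G], [gap_block] bounds the other variable. If
    both exceed [G >= L], corresponding blocks are equal and the occurrence is a square, which
    [w_gap] bounds. *)
Lemma alternating_blocks c d :
  L <= G -> occurs_via w sigma [:: c; d; c; d] ->
  size (sigma c) < M /\ size (sigma d) < M.
Proof.
move=> LG occ.
have c_or : size (sigma d) <= G -> size (sigma c) < M.
  move=> dG; apply: (@gap_block c [:: d]); last by rewrite big_seq1.
  by apply: occurs_via_infix occ; apply/infixP; exists [::], [:: d].
have d_or : size (sigma c) <= G -> size (sigma d) < M.
  move=> cG; apply: (@gap_block d [:: c]); last by rewrite big_seq1.
  by apply: occurs_via_infix occ; apply/infixP; exists [:: c], [::].
have [dG|Gd] := leqP (size (sigma d)) G.
  have cM := c_or dG; split=> //.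
  by have [/d_or //|Gc] := leqP (size (sigma c)) G; lia.
have [cG|Gc] := leqP (size (sigma c)) G; first by have := d_or cG; split; lia.
have := occ.
move=> [X [i [/realizes_cons[u1 [? [-> cu1]]]]]].
move=> /realizes_cons[v1 [? [-> dv1]]] /realizes_cons[u2 [? [-> cu2]]].
move=> /realizes_cons[v2 [? [-> dv2 /realizes_nil ->]]].
rewrite /= cats0 => /cat_window[eq_u1 /cat_window[eq_v1 /cat_window[eq_u2 eq_v2]]].
set m := size (sigma c) in Gc c_or d_or *; set n := size (sigma d) in Gd c_or d_or *.
have [sz_u1 sz_u2] : size u1 = m /\ size u2 = m by split; apply: size_undirected.
have [sz_v1 sz_v2] : size v1 = n /\ size v2 = n by split; apply: size_undirected.
rewrite sz_u1 sz_v1 ?sz_u2 in eq_u1 eq_v1 eq_u2.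
rewrite sz_u1 sz_v1 sz_u2 sz_v2 in eq_v2.
have u_eq : forall t, t < m -> w (i + t) = w (i + m + n + t).
  apply: long_blocks_eq; first by lia.
  by rewrite -eq_u1 -eq_u2; apply: undirected_trans cu2; rewrite undirected_sym.
have v_eq : forall t, t < n -> w (i + m + t) = w (i + m + n + m + t).
  apply: long_blocks_eq; first by lia.
  by rewrite -eq_v1 -eq_v2; apply: undirected_trans dv2; rewrite undirected_sym.
suff : m + n < M by split; lia.
rewrite ltnNge; apply/negP => le_M.
apply: (@w_gap i (m + n) (m + n)); [lia..|].
move=> t t_lt.
have [tm|mt] := ltnP t m; first by rewrite u_eq // !addnA.
have := v_eq (t - m); rewrite -!addnA subnKC // => -> //; last by lia.
Qed.

End LongBlocks.

(** * Avoidance certificates checked by computation *)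

(** A pair of numbers as a function on variables, the first for [x] and the second for [y]; it
    supplies both the lower bounds and the ranges of block lengths. *)
Definition block_length (lo len : nat) (c : bool) := if c then len else lo.

Section Certificate.
Variables (k q : nat) (h : seq (seq nat)).

Local Notation w := (image_word source h q).

(** The quotient is the ceiling of [(n + q - 1) / q], the number of blocks that contain [n] letters
    at any offset. *)
Lemma leq_windows n : 0 < q -> n + q <= (q * ((n + 2 * q - 2) %/ q)).+1.
Proof.
move=> q_gt0; have := ltn_ceil (n + 2 * q - 2) q_gt0.
by rewrite [X in _ < X]mulnC [X in _ < X]mulnS; lia.
Qed.

Definition word_windows n :=
  image_windows h q (source_windows ((n + 2 * q - 2) %/ q)) n.

(* Factors zaz of the image with |a| <= G and |z| >= long_repeat G come from
   factors of the source excluded by source_repeats. *)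
Definition source_gap G := (G + 2 * q - 2) %/ q.

Definition long_repeat G := q * (2 * source_gap G + 1) + 2 * q - 2.

(** The entry for [P] is the least [n] with [M <= n] and [P <= n + G]. *)
Definition thresholds G M :=
  [seq maxn M (P - G) | P <- iota 1 (long_repeat G + G)].

Definition morphism_ok l := [&& 0 < k, 0 < q, size h == 4, all (fun s => size s == q) h,
  all (all (fun a => a < k)) h, uniq h &
  synchronizing h q (source_windows ((l + 2 * q - 2) %/ q)) l].

Definition reverse_free_ok L := let W := word_windows L.+1 in
  all (fun a => let a' := rev a in all (fun b => ~~ agree L.+1 a' b) W) W.

Definition gap_free_ok l G M := [&& 0 < M, l <= long_repeat G, source_gap G <= 8 &
  let ns := thresholds G M in
  all (fun r => no_repeats ns r r) (word_windows (2 * long_repeat G + G + M))].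

(** The windows are as long as the longest occurrence within the bounds, so every such occurrence is
    a prefix of one of them. *)
Definition free_of lo len p :=
  all (fun r => ~~ matches lo len p no_env r)
      (word_windows (sumn [seq lo c + len c | c <- p])).

Hypothesis q_gt0 : 0 < q.
Hypothesis size_h : size h = 4.
Hypothesis uniform : all (fun s => size s == q) h.

Lemma source_lt_h i : source i < size h.
Proof. by rewrite size_h; apply: source_lt. Qed.

Lemma word_windowsP n i : window w i n \in word_windows n.
Proof.
apply: mem_image_windows => //; first exact: source_lt_h.
  by move=> j; apply: source_windowsP.
exact: leq_windows.
Qed.

Lemma reverse_freeP L : reverse_free_ok L -> reverse_free w L.
Proof.
move=> /allP ok a b rev_ab.
have /allP/(_ _ (word_windowsP _ b)) := ok _ (word_windowsP _ a).
case/negP; apply: agreeP => t tL _ _.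
rewrite nth_rev ?size_window // !nth_window; [|lia..].
by rewrite rev_ab; [congr (w (_ + _))|]; lia.
Qed.

(** Periods up to [long_repeat G + G] are excluded by inspecting windows. A larger one forces
    [n > long_repeat G], and then synchronization carries the repetition to [source]. *)
Lemma gap_freeP l G M : uniq h ->
  synchronizing h q (source_windows ((l + 2 * q - 2) %/ q)) l ->
  gap_free_ok l G M -> gap_free w G M.
Proof.
move=> uniq_h sync /and4P[M_gt0 le_l le_8 ok] i P n P_gt0 le_P le_M rep.
have [P_le|P_gt] := leqP P (long_repeat G + G).
  have P_lt : P.-1 < size (thresholds G M) by rewrite size_map size_iota; lia.
  have := no_repeatsP (allP ok _ (word_windowsP _ i)) P_lt.
  rewrite prednK // => /negP[].
  rewrite (nth_map 0) ?size_iota ?nth_iota; [|lia..].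
  by apply: repeats_agree rep; lia.
have sync_w a b : (forall t, t < l -> w (a + t) = w (b + t)) -> a = b %[mod q].
  apply: (synchronizingP q_gt0 uniform source_lt_h _ _ sync) => [j|].
    exact: source_windowsP.
  exact: leq_windows.
have le_ln : l <= n by lia.
have [i' [P' [n' [eq_P le_n _]]]] :=
  repeats_image q_gt0 uniform source_lt_h sync_w uniq_h le_ln rep.
have := ltn_ceil (G + 2 * q - 2) q_gt0; rewrite -/(source_gap G) => lt_gap.
have lt_P' : P' < n' + (source_gap G).+1.
  by rewrite -(ltn_pmul2l q_gt0) mulnDr -eq_P [q * _.+1]mulnC; lia.
(* Here [n > long_repeat G] and [n <= q * n' + 2 * q - 2] are combined; together with
   [P' <= n' + source_gap G] this gives [2 * P' < 3 * n']. *)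
have lt_n' : 2 * source_gap G < n'.
  rewrite -(ltn_pmul2l q_gt0); move: P_gt; rewrite /long_repeat mulnDr; lia.
by apply: source_repeats; lia.
Qed.

Lemma free_ofP lo len p sigma :
  free_of lo len p -> occurs_via w sigma p ->
  ~ (forall c, c \in p -> lo c < size (sigma c) <= lo c + len c).
Proof.
move=> /allP ok [X [i [pX eqX]]] bnd.
pose n := sumn [seq lo c + len c | c <- p].
have le_n : size (flatten X) <= n.
  rewrite (size_realizes pX) /n sumnE big_map big_seq [X in _ <= X]big_seq.
  by apply: leq_sum => c /bnd/andP[].
have /negP[] := ok _ (word_windowsP n i).
rewrite -(subnKC le_n) window_add -eqX.
exact: matches_complete pX _ bnd.
Qed.

Lemma avoidable_image p : 0 < k -> all (all (fun a => a < k)) h ->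
  (forall sigma, (forall c, sigma c != [::]) -> ~ occurs_via w sigma p) ->
  avoidable_on p k.
Proof.
move=> k_gt0 letters no_occ; split=> //.
have w_lt i : w i < k by apply: letters_bounded.
exists (fun i => Ordinal (w_lt i)) => /(encounters_map val)/encountersP[sigma [? ?]].
exact: (no_occ sigma).
Qed.

End Certificate.

Section Certificates.
Variables (k q l L G M : nat) (h : seq (seq nat)) (p : pattern).

Definition base_certificate := [&& morphism_ok k q h l, reverse_free_ok q h L,
  gap_free_ok q h l G M & L < M].

(* S bounds the length of every u such that uu' occurs, u' being u or its reversal. *)
Definition square_certificate S c :=
  [&& base_certificate, infix [:: false; false] p,
      (true \notin p) || (infix (true :: rcons (nseq c false) true) p && (c * S <= G)),
      free_of q h (block_length S 0) (block_length (M.-1 - S) 0) [:: false; false]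
    & free_of q h (block_length 0 0) (block_length S M.-1) p].

Definition alternating_certificate :=
  [&& base_certificate, infix [:: false; true; false; true] p, L <= G
    & free_of q h (block_length 0 0) (block_length M.-1 M.-1) p].

(** The factor [xx] bounds the blocks of [x] by [M], and a search lowers this bound to [S]. The
    blocks of [x] between two neighbouring blocks of [y] then fit into the gap [G], which bounds
    those of [y]; a finite search remains. *)
Lemma square_certificateP S c : square_certificate S c -> avoidable_on p k.
Proof.
case/and5P=> /and4P[/and5P[k_gt0 q_gt0 /eqP size_h unif /and3P[lett uniq_h sync]]].
move=> /(reverse_freeP q_gt0 size_h unif) w_rev.
move=> /(gap_freeP q_gt0 size_h unif uniq_h sync) w_gap LM.
move=> xx_p y_p free_xx free_p.
apply: (avoidable_image (q := q) k_gt0 lett) => sigma sigma0 occ.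
have size_gt0 d : 0 < size (sigma d) by rewrite lt0n size_eq0.
have occ_xx := occurs_via_infix xx_p occ.
have x_lt : size (sigma false) < M.
  by apply: (gap_block w_rev w_gap LM (m := [::]) occ_xx); rewrite big_nil.
have x_le : size (sigma false) <= S.
  rewrite leqNgt; apply/negP => S_lt.
  apply: (free_ofP q_gt0 size_h unif free_xx occ_xx) => d.
  by rewrite !inE orbb => /eqP->; rewrite /block_length; lia.
apply: (free_ofP q_gt0 size_h unif free_p occ) => -[] dp;
  rewrite /block_length /= size_gt0 add0n //.
  move: y_p; rewrite dp /= => /andP[y_p cS].
  have : size (sigma true) < M.
    apply: (gap_block w_rev w_gap LM (occurs_via_infix y_p occ)).
    by rewrite big_nseq iter_addn_0 mulnC (leq_trans _ cS) // leq_mul2l x_le orbT.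
  by move=> /=; lia.
Qed.

Lemma alternating_certificateP : alternating_certificate -> avoidable_on p k.
Proof.
case/and4P=> /and4P[/and5P[k_gt0 q_gt0 /eqP size_h unif /and3P[lett uniq_h sync]]].
move=> /(reverse_freeP q_gt0 size_h unif) w_rev.
move=> /(gap_freeP q_gt0 size_h unif uniq_h sync) w_gap LM.
move=> alt_p LG free_p.
apply: (avoidable_image (q := q) k_gt0 lett) => sigma sigma0 occ.
have size_gt0 d : 0 < size (sigma d) by rewrite lt0n size_eq0.
have [x_lt y_lt] := alternating_blocks w_rev w_gap LM LG (occurs_via_infix alt_p occ).
by apply: (free_ofP q_gt0 size_h unif free_p occ) => -[] _;
  rewrite /block_length /= size_gt0 add0n; lia.
Qed.

End Certificates.

(** * Avoidable patterns over two and three letters *)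

Local Notation x := false.
Local Notation y := true.

(* The morphisms were found by a computer search; the bounds l, L, G, M, S are then
   read off the factors of the image word. *)
Lemma avoidable_xxxx : avoidable_on [:: x; x; x; x] 2.
Proof.
apply: (@square_certificateP 2 5 9 12 0 13 [:: [:: 1; 1; 0; 1; 1];
      [:: 0; 0; 1; 0; 0];
      [:: 1; 1; 1; 0; 1];
      [:: 0; 0; 0; 1; 0]] _ 4 0).
by vm_cast_no_check (erefl true).
Qed.

Lemma avoidable_xxxyyy : avoidable_on [:: x; x; x; y; y; y] 2.
Proof.
apply: (@square_certificateP 2 6 7 11 0 12 [:: [:: 0; 0; 1; 0; 0; 0];
      [:: 1; 1; 0; 1; 1; 1];
      [:: 0; 1; 0; 1; 1; 1];
      [:: 1; 0; 1; 0; 0; 0]] _ 6 0).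
by vm_cast_no_check (erefl true).
Qed.

Lemma avoidable_xxyxyy : avoidable_on [:: x; x; y; x; y; y] 2.
Proof.
apply: (@square_certificateP 2 6 7 11 0 12 [:: [:: 0; 1; 0; 0; 0; 1];
      [:: 0; 1; 0; 0; 0; 0];
      [:: 0; 1; 1; 1; 0; 1];
      [:: 1; 1; 1; 1; 0; 1]] _ 6 0).
by vm_cast_no_check (erefl true).
Qed.

Lemma avoidable_xxyyyx : avoidable_on [:: x; x; y; y; y; x] 2.
Proof.
apply: (@square_certificateP 2 6 13 8 0 12 [:: [:: 1; 1; 0; 0; 1; 0];
      [:: 0; 0; 1; 1; 0; 1];
      [:: 0; 1; 1; 1; 0; 0];
      [:: 1; 0; 0; 0; 1; 1]] _ 10 0).
by vm_cast_no_check (erefl true).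
Qed.

Lemma avoidable_xxyyx : avoidable_on [:: x; x; y; y; x] 2.
Proof.
apply: (@square_certificateP 2 26 18 17 0 18
  [:: [:: 0; 1; 1; 1; 0; 0; 0; 1; 1; 1; 0; 1; 1; 1; 1; 0; 0; 0; 1; 1; 1; 0; 1; 1; 0; 0];
      [:: 0; 1; 1; 1; 0; 0; 0; 1; 0; 0; 0; 0; 1; 1; 1; 0; 1; 0; 0; 1; 1; 1; 0; 0; 0; 1];
      [:: 0; 1; 1; 1; 0; 0; 0; 1; 1; 1; 0; 1; 0; 0; 1; 0; 0; 0; 0; 1; 1; 1; 0; 1; 0; 0];
      [:: 0; 1; 1; 1; 0; 0; 0; 1; 0; 1; 1; 0; 0; 0; 1; 1; 1; 0; 1; 1; 1; 1; 0; 0; 0; 1]] _ 11 0).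
by vm_cast_no_check (erefl true).
Qed.

(** Here and in the next four lemmas [c > 0] blocks of [x] separate two blocks of [y], and [G] is
    [c * S]. *)
Lemma avoidable_xyxxyx : avoidable_on [:: x; y; x; x; y; x] 2.
Proof.
apply: (@square_certificateP 2 5 5 8 10 17 [:: [:: 0; 1; 0; 0; 0];
      [:: 0; 1; 1; 1; 1];
      [:: 0; 1; 1; 0; 0];
      [:: 0; 1; 1; 1; 0]] _ 5 2).
by vm_cast_no_check (erefl true).
Qed.

(** This is [xyxyyx] with the variables exchanged, because the certificate asks for the factor
    [xx]. *)
Lemma avoidable_yxyxxy : avoidable_on [:: y; x; y; x; x; y] 2.
Proof.
apply: (@square_certificateP 2 4 8 14 6 15 [:: [:: 1; 1; 0; 0];
      [:: 1; 1; 0; 1];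
      [:: 0; 0; 0; 0];
      [:: 0; 1; 1; 1]] _ 6 1).
by vm_cast_no_check (erefl true).
Qed.

Lemma avoidable_xxyxxy : avoidable_on [:: x; x; y; x; x; y] 2.
Proof.
apply: (@square_certificateP 2 5 7 13 4 15 [:: [:: 1; 1; 0; 1; 0];
      [:: 0; 0; 1; 0; 1];
      [:: 1; 1; 0; 0; 0];
      [:: 0; 0; 1; 1; 1]] _ 2 2).
by vm_cast_no_check (erefl true).
Qed.

Lemma avoidable_xyxxxy : avoidable_on [:: x; y; x; x; x; y] 2.
Proof.
apply: (@square_certificateP 2 5 8 12 12 14 [:: [:: 0; 0; 1; 0; 0];
      [:: 1; 1; 0; 1; 1];
      [:: 0; 0; 0; 0; 1];
      [:: 1; 1; 1; 1; 0]] _ 4 3).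
by vm_cast_no_check (erefl true).
Qed.

Lemma avoidable_xxxyxy : avoidable_on [:: x; x; x; y; x; y] 2.
Proof.
apply: (@square_certificateP 2 7 9 15 7 21 [:: [:: 1; 0; 1; 0; 1; 1; 1];
      [:: 1; 1; 0; 0; 0; 0; 1];
      [:: 1; 1; 1; 0; 0; 1; 0];
      [:: 1; 0; 0; 0; 0; 0; 1]] _ 7 1).
by vm_cast_no_check (erefl true).
Qed.

(** With neither [xx] nor [yy] available, the factor [xyxy] bounds both variables. *)
Lemma avoidable_xyxyx : avoidable_on [:: x; y; x; y; x] 2.
Proof.
apply: (@alternating_certificateP 2 10 7 16 16 27 [:: [:: 0; 1; 1; 1; 1; 0; 1; 1; 0; 0];
      [:: 0; 1; 1; 1; 1; 0; 1; 0; 0; 1];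
      [:: 0; 1; 1; 1; 0; 0; 1; 0; 0; 0];
      [:: 0; 1; 0; 1; 1; 0; 1; 0; 0; 0]]).
by vm_cast_no_check (erefl true).
Qed.

Lemma avoidable_xyxy : avoidable_on [:: x; y; x; y] 3.
Proof.
apply: (@alternating_certificateP 3 5 5 3 3 13 [:: [:: 2; 1; 1; 0; 0];
      [:: 2; 1; 1; 1; 0];
      [:: 2; 1; 0; 0; 2];
      [:: 2; 1; 0; 2; 2]]).
by vm_cast_no_check (erefl true).
Qed.

Lemma avoidable_xx : avoidable_on [:: x; x] 3.
Proof.
apply: (@square_certificateP 3 18 10 25 0 26
  [:: [:: 0; 2; 0; 1; 2; 1; 0; 2; 1; 2; 0; 2; 1; 0; 1; 2; 0; 1];
      [:: 0; 2; 0; 1; 2; 1; 0; 2; 0; 1; 0; 2; 1; 0; 1; 2; 0; 1];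
      [:: 0; 2; 0; 1; 2; 0; 2; 1; 2; 0; 1; 2; 1; 0; 1; 2; 0; 1];
      [:: 0; 2; 0; 1; 2; 0; 2; 1; 0; 2; 0; 1; 0; 2; 1; 2; 0; 1]] _ 0 0).
by vm_cast_no_check (erefl true).
Qed.

(** * Unavoidability over two letters by backtracking *)

Definition starts (E : seq (seq nat)) r :=
  has (fun e => if strip e r is Some _ then true else false) E.

(* Words are extended to the right but stored reversed; the extension first reads f.
   Every branch must end with a word of E or an occurrence of p. *)
Fixpoint dead_end d p E f r : bool :=
  if starts E r then true
  else if matches (fun=> 0) (fun=> 60) p no_env r then true
  else if d is d'.+1 then
    match f with
    | a :: f' => dead_end d' p E f' (a :: r)
    | [::] =>
        if dead_end d' p E [::] (0 :: r) then dead_end d' p E [::] (1 :: r) else false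
    end
  else false.

(** A word shown not to occur joins [E], stored reversed, and prunes the later searches. *)
Fixpoint eliminates d p E fs : bool :=
  if fs is f :: fs' then
    if dead_end d p E f [::] then eliminates d p (rev f :: E) fs' else false
  else true.

Section Elimination.
Variables (w : nat -> nat) (p : pattern).
Hypotheses (w_lt2 : forall i, w i < 2) (w_avoids : ~ encounters w (rev p)).

Lemma starts_window E i n :
  (forall e i' n', e \in E -> window w i' n' <> rev e) ->
  starts E (rev (window w i n)) = false.
Proof.
move=> noE; apply/negP => /hasP[e eE].
case eq_r: (strip _ _) => [r|] // _; move/stripP: eq_r => /(congr1 rev).
rewrite revK rev_cat -[rev e]cats0 => /window_split eq_e.
exact: noE eE (esym eq_e).
Qed.

Lemma matches_window lo len i n :
  matches lo len p no_env (rev (window w i n)) = false.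
Proof.
apply/negP => /matches_sound[//|sigma [X [r [sigma0 _ pX]]]].
move=> /(congr1 rev); rewrite revK rev_cat rev_flatten => eq_w.
apply/w_avoids/(@occurs_in_encounters _ w i n).
exists sigma, (rev (map rev X)); split=> //; first exact: realizes_rev.
by rewrite eq_w suffix_infix.
Qed.

Lemma dead_endP d E f i n :
  (forall e i' n', e \in E -> window w i' n' <> rev e) ->
  dead_end d p E f (rev (window w i n)) -> f <> window w (i + n) (size f).
Proof.
move=> noE; elim: d f n => [|d IH] f n /=;
  rewrite starts_window // matches_window //.
case: f => [|a f] dead.
  case: ifP dead => // dead0 dead1 _.
  have : w (i + n) \in [:: 0; 1] by rewrite !inE; have := w_lt2 (i + n); lia.
  rewrite !inE => /orP[] /eqP eq_w.
    by apply: (IH [::] n.+1); rewrite // window_rcons rev_rcons eq_w.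
  by apply: (IH [::] n.+1); rewrite // window_rcons rev_rcons eq_w.
rewrite [size _]/= windowS => -[eq_a]; rewrite -addnS.
by apply: IH; rewrite window_rcons rev_rcons -eq_a.
Qed.

Lemma eliminatesP d E fs f i :
  (forall e i' n', e \in E -> window w i' n' <> rev e) ->
  eliminates d p E fs -> f \in fs -> f <> window w i (size f).
Proof.
elim: fs E => //= f' fs IH E noE; case: ifP => // dead elim_fs.
have no_f' j : f' <> window w j (size f').
  by have := @dead_endP d E f' j 0 noE dead; rewrite addn0.
rewrite inE => /orP[/eqP-> //|]; apply: IH elim_fs => e j n.
rewrite inE => /orP[/eqP->|]; last exact: noE.
by rewrite revK => eq_f'; apply: (no_f' j); rewrite -eq_f' size_window.
Qed.

End Elimination.

(** The empty word occurs everywhere, so eliminating it is a contradiction. The search looks for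
    [rev p] because it stores words reversed. *)
Lemma unavoidable_elimination d p fs :
  eliminates d (rev p) [::] fs -> [::] \in fs -> ~ avoidable_on p 2.
Proof.
move=> elim_fs nil_fs [_ [w av]].
have av' : ~ encounters (val \o w) (rev (rev p)).
  rewrite revK => /(encounters_map (inord : nat -> 'I_2)) enc.
  by apply/av/(eq_encounters _ enc) => i; rewrite /= inord_val.
apply: (@eliminatesP _ _ (fun i => ltn_ord (w i)) av' d [::] fs [::] 0) => //.
Qed.

(* The factors to eliminate and their order are chosen to keep the search trees small. *)
Lemma unavoidable_xxx : ~ avoidable_on [:: x; x; x] 2.
Proof.
apply: (@unavoidable_elimination 100 _ [:: [::]]); last by [].
by vm_cast_no_check (erefl true).
Qed.

Lemma unavoidable_xxxyy : ~ avoidable_on [:: x; x; x; y; y] 2.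
Proof.
apply: (@unavoidable_elimination 100 _
  [:: [:: 0; 0; 0; 1]; [:: 1; 1; 1; 0]; [:: 0; 0; 0]; [:: 1; 1; 1]; [:: 0; 1; 1];
    [:: 1; 0; 0]; [::]]); last by [].
by vm_cast_no_check (erefl true).
Qed.

Lemma unavoidable_xyyyx : ~ avoidable_on [:: x; y; y; y; x] 2.
Proof.
apply: (@unavoidable_elimination 100 _
  [:: [:: 0; 0; 1; 1]; [:: 1; 1; 0; 0]; [:: 0; 1; 1; 1]; [:: 1; 0; 0; 0];
    [:: 0; 1; 0; 1]; [:: 1; 0; 1; 0]; [::]]); last by [].
by vm_cast_no_check (erefl true).
Qed.

Lemma unavoidable_xxyxy : ~ avoidable_on [:: x; x; y; x; y] 2.
Proof.
apply: (@unavoidable_elimination 100 _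
  [:: [:: 0; 0; 0; 0]; [:: 1; 1; 1; 1]; [:: 0; 0; 1; 1]; [:: 1; 1; 0; 0]; [::]]); last by [].
by vm_cast_no_check (erefl true).
Qed.

Lemma unavoidable_yxxyx : ~ avoidable_on [:: y; x; x; y; x] 2.
Proof.
apply: (@unavoidable_elimination 100 _
  [:: [:: 0; 0; 0; 1; 1; 0]; [:: 1; 1; 1; 0; 0; 1]; [:: 0; 0; 1; 1; 1; 1];
    [:: 1; 1; 0; 0; 0; 0]; [:: 0; 0; 1; 1; 0]; [:: 1; 1; 0; 0; 1];
    [:: 0; 1; 1; 1; 0; 0]; [:: 1; 0; 0; 0; 1; 1]; [:: 0; 1; 0; 0; 0];
    [:: 1; 0; 1; 1; 1]; [:: 0; 1; 0; 0]; [:: 1; 0; 1; 1]; [::]]); last by [].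
by vm_cast_no_check (erefl true).
Qed.

(** * Values of the index and the remaining unavoidable patterns *)

Lemma lambda_someP p k :
  avoidable_on p k -> (forall j, j < k -> ~ avoidable_on p j) -> lambda p = Some k.
Proof.
move=> av minimal; rewrite /lambda; case: pselect => [ex|[]]; last first.
  by exists k; apply/asboolP.
case: ex_minnP => m /asboolP av_m le_m; congr Some; apply/eqP.
rewrite eqn_leq le_m ?andTb; last exact/asboolP.
by rewrite leqNgt; apply/negP => /minimal /(_ av_m).
Qed.

Lemma lambda_noneP p : (forall k, ~ avoidable_on p k) -> lambda p = None.
Proof.
move=> unav; rewrite /lambda; case: pselect => // ex.
by exfalso; case: ex => k /asboolP; apply: unav.
Qed.

Lemma unavoidable_unary p k : k <= 1 -> ~ avoidable_on p k.
Proof.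
case: k => [|[|//]] _ [// _ [w av]]; apply: av; apply/encountersP.
exists (fun=> [:: w 0]); split=> //; exists (nseq (size p) [:: w 0]), 0; split.
  by rewrite /realizes; elim: p => //= c p ->; rewrite undirected_refl.
apply: (@eq_from_nth _ (w 0)); rewrite ?size_window // => i _.
by apply: val_inj; rewrite !ord1.
Qed.

Lemma unavoidable_x k : ~ avoidable_on (nseq 1 x) k.
Proof.
move=> [_ [w av]]; apply: av; apply/encountersP.
exists (fun=> [:: w 0]); split=> //; exists [:: [:: w 0]], 0; split=> //.
by rewrite /realizes /= undirected_refl.
Qed.

Lemma unavoidable_xxxyxxx : ~ avoidable_on [:: x; x; x; y; x; x; x] 2.
Proof. exact: (unavoidable_sandwich (m := 3) unavoidable_xxx). Qed.

Lemma unavoidable_xyxxy : ~ avoidable_on [:: x; y; x; x; y] 2.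
Proof. by move=> /avoidable_rev/unavoidable_yxxyx. Qed.

(** * Finite classification of patterns by their factors *)

Definition equivalents p := [:: p; swap p; rev p; rev (swap p)].

Definition has_factor_in (B : seq pattern) p := has (fun b => infix b p) B.

Fixpoint patterns_avoiding (B : seq pattern) n : seq pattern :=
  if n is m.+1 then
    let F := patterns_avoiding B m in
    [seq p <- map (cons x) F ++ map (cons y) F | ~~ has_factor_in B p]
  else [:: [::]].

Lemma has_factor_in_infix B p q :
  infix p q -> has_factor_in B p -> has_factor_in B q.
Proof.
by move=> pq /hasP[b bB bp]; apply/hasP; exists b; rewrite ?(infix_trans bp).
Qed.

Lemma patterns_avoidingP B p :
  ~~ has_factor_in B p -> p \in patterns_avoiding B (size p).
Proof.
elim: p => // c p IH no_B.
have p_in : p \in patterns_avoiding B (size p).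
  apply: IH; apply: contra no_B; apply: has_factor_in_infix.
  by rewrite -cat1s suffix_infix.
rewrite [patterns_avoiding _ _]/= mem_filter no_B mem_cat.
by case: c {no_B}; rewrite map_f ?orbT.
Qed.

Lemma patterns_avoiding_bounded B N p :
  patterns_avoiding B N = [::] -> ~~ has_factor_in B p -> size p < N.
Proof.
move=> emptyN no_B; rewrite ltnNge; apply/negP => le_N.
have : take N p \in patterns_avoiding B N.
  rewrite -[in X in _ \in X](size_takel le_N); apply: patterns_avoidingP.
  apply: contra no_B; apply: has_factor_in_infix.
  by rewrite -[X in infix _ X](cat_take_drop N) prefix_infix.
by rewrite emptyN.
Qed.

(** If no pattern of length [N] avoids [B], those avoiding it are all shorter, and [Q] can be
    checked on each. *)
Lemma patterns_avoiding_cases B N (Q : pattern -> bool) p :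
  patterns_avoiding B N = [::] ->
  all (fun n => all Q (patterns_avoiding B n)) (iota 0 N) ->
  ~~ has_factor_in B p -> Q p.
Proof.
move=> emptyN allQ no_B; have lt_N := patterns_avoiding_bounded emptyN no_B.
have /allP/(_ (size p)) := allQ; rewrite mem_iota => /(_ lt_N)/allP; apply.
exact: patterns_avoidingP.
Qed.

Definition two_avoidable := flatten (map equivalents (xxxx :: P)).

Definition three_avoidable :=
  [:: [:: x; x]; [:: y; y]; [:: x; y; x; y]; [:: y; x; y; x]].

(** Every pattern without a factor in [two_avoidable] is a factor of one of these, so five
    unavoidability results suffice. *)
Definition two_unavoidable := flatten (map equivalents
  [:: [:: x; x; x; y; y]; [:: x; y; x; x; y]; [:: x; y; y; y; x]; [:: x; x; y; x; y];
      [:: x; x; x; y; x; x; x]]).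

Lemma mem_equivalents (F : seq pattern) f :
  f \in flatten (map equivalents F) -> exists2 q, q \in F & equivalent q f.
Proof. by move=> /flatten_mapP[q qF fq]; exists q. Qed.

Lemma factor_two_avoidable p :
  has_factor_equivalent_to_xxxx_or_P p <-> has_factor_in two_avoidable p.
Proof.
split=> [[f fp eq_f]|/hasP[f /mem_equivalents[q qP eq_q] fp]].
  apply/hasP; exists f => //; apply/flatten_mapP.
  case: eq_f => [/equivalent_sym|[q qP /equivalent_sym]] eq_f.
    by exists xxxx; rewrite // mem_head.
  by exists q; rewrite // inE qP orbT.
exists f => //; move: qP; rewrite inE => /orP[/eqP eq_x|qP].
  by left; rewrite -eq_x; apply: equivalent_sym.
by right; exists q => //; apply: equivalent_sym.
Qed.

Lemma avoidable_P q : q \in xxxx :: P -> avoidable_on q 2.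
Proof.
rewrite !inE; do 11?[case/orP=> [/eqP->|]]; last move/eqP->.
- exact: avoidable_xxxx.
- exact: avoidable_xxyyx.
- exact: avoidable_xyxyx.
- exact: avoidable_xxxyxy.
- exact: (avoidable_infix _ avoidable_xxyyx).
- exact: avoidable_xxxyyy.
- exact: avoidable_xxyxxy.
- exact: avoidable_xxyxyy.
- exact: avoidable_xxyyyx.
- exact: avoidable_xyxxxy.
- exact: avoidable_xyxxyx.
- exact: (avoidable_swap avoidable_yxyxxy).
Qed.

Lemma unavoidable_two p : ~~ has_factor_in two_avoidable p -> ~ avoidable_on p 2.
Proof.
move=> no_B av.
have : has (fun m => infix p m) two_unavoidable.
  pose Q r := has (fun m => infix r m) two_unavoidable.
  (* Every pattern of length 8 has a factor in [two_avoidable]. *)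
  by apply: (@patterns_avoiding_cases two_avoidable 8 Q) no_B; vm_compute.
case/hasP=> m /mem_equivalents[q q_max /equivalent_sym eq_mq] pm.
have := avoidable_equivalent eq_mq (avoidable_infix pm av).
move: q_max; rewrite !inE; do 4?[case/orP=> [/eqP->|]]; last move/eqP->.
- exact: unavoidable_xxxyy.
- exact: unavoidable_xyxxy.
- exact: unavoidable_xyyyx.
- exact: unavoidable_xxyxy.
- exact: unavoidable_xxxyxxx.
Qed.

Lemma avoidable_three p : ~ equivalent_to_factor_of_xyx p -> avoidable_on p 3.
Proof.
move=> not_f; have : has_factor_in three_avoidable p.
  apply/negPn/negP => no_B; apply: not_f.
  have : has (fun f => infix f xyx && equivalent p f)
      [:: [::]; [:: x]; [:: x; y]; [:: x; y; x]].
    pose Q r := has (fun f => infix f xyx && equivalent r f)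
      [:: [::]; [:: x]; [:: x; y]; [:: x; y; x]].
    (* A pattern of length 4 without [xx] and [yy] alternates, so it is [xyxy] or [yxyx]. *)
    by apply: (@patterns_avoiding_cases three_avoidable 4 Q) no_B; vm_compute.
  by case/hasP=> f _ /andP[fx eq_f]; exists f.
case/hasP=> f + fp; have avf : avoidable_on f 3 -> avoidable_on p 3.
  exact: avoidable_infix.
rewrite !inE; do 3?[case/orP=> [/eqP eq_f|]]; last move=> /eqP eq_f;
  apply: avf; rewrite eq_f.
- exact: avoidable_xx.
- exact: (avoidable_swap avoidable_xx).
- exact: avoidable_xyxy.
- exact: (avoidable_swap avoidable_xyxy).
Qed.

Theorem theorem9 (p : pattern) :
  (equivalent_to_factor_of_xyx p -> lambda p = None) /\
  (has_factor_equivalent_to_xxxx_or_P p -> lambda p = Some 2) /\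
  (~ equivalent_to_factor_of_xyx p -> ~ has_factor_equivalent_to_xxxx_or_P p ->
     lambda p = Some 3).
Proof.
split=> [[f f_xyx eq_pf]|].
  apply: lambda_noneP => k /(avoidable_equivalent eq_pf)/(avoidable_infix f_xyx).
  exact: (unavoidable_sandwich (m := 1) (@unavoidable_x k)).
split=> [/factor_two_avoidable/hasP[f /mem_equivalents[q qP eq_q] fp]|not_f no_B].
  apply: lambda_someP => [|j j_lt]; last exact: unavoidable_unary.
  exact/(avoidable_infix fp)/(avoidable_equivalent eq_q)/avoidable_P.
apply: lambda_someP => [|j]; first exact: avoidable_three.
rewrite ltnS leq_eqVlt => /orP[/eqP->|]; last exact: unavoidable_unary.
by apply: unavoidable_two; apply/negP => /factor_two_avoidable.
Qed.
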